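(* Any hermitian bilinear form $\lambda$ has a universal commutative quadratic refinement $\mu^c_\lambda$. In fact, the forgetful functor $R(\lambda,\mu)=\lambda$ from the category $\mathsf{CQF}$ of commutative quadratic forms to the category $\mathsf{HF}$ of hermitian forms has a left adjoint $L:\mathsf{HF}\to\mathsf{CQF}$, $L(\lambda)=(\lambda,\mu^c_\lambda)$.
   Context: A commutative quadratic group $\mathfrak M=(M_e\overset{h}{\to}M_{ee}\overset{p}{\to}M_e)$ consists of two abelian groups $M_e,M_{ee}$ and two homomorphisms $h,p$ satisfying $ph=2\,\mathrm{id}$ on $M_e$. Then $*:=hp-\mathrm{id}$ is an involution on $M_{ee}$. A morphism $\beta:\mathfrak M\to\mathfrak M'$ is a pair of homomorphisms $\beta_e:M_e\to M'_e$, $\beta_{ee}:M_{ee}\to M'_{ee}$ with $h'\beta_e=\beta_{ee}h$ and $p'\beta_{ee}=\beta_e p$. A commutative quadratic form $(\lambda,\mu):A\to\mathfrak M$ on an abelian group $A$ with values in a commutative quadratic group $\mathfrak M$ is a bilinear map $\lambda:A\times A\to M_{ee}$ and a map $\mu:A\to M_e$ with $\mu(a+a')=\mu(a)+\mu(a')+p(\lambda(a,a'))$ and $h(\mu(a))=\lambda(a,a)$ for all $a,a'\in A$. The category $\mathsf{CQF}$ has these as objects ($A$ and $\mathfrak M$ being part of the data); a morphism $(\lambda,\mu)\to(\lambda',\mu')$ is a homomorphism $\alpha:A\to A'$ and a morphism $\beta:\mathfrak M\to\mathfrak M'$ with $\lambda'(\alpha(a_1),\alpha(a_2))=\beta_{ee}(\lambda(a_1,a_2))$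 and $\mu'\circ\alpha=\beta_e\circ\mu$. A hermitian form $\lambda:A\times A\to(M,* )$ is a bilinear map into an abelian group with involution such that $\lambda(a',a)=\lambda(a,a')^*$. The category $\mathsf{HF}$ has these as objects ($A$ and $(M,* )$ being part of the data); a morphism $\lambda\to\lambda'$ is a pair of homomorphisms $\alpha:A\to A'$, $\beta_{ee}:(M,* )\to(M',*')$, the latter commuting with the involutions, with $\lambda'(\alpha(a_1),\alpha(a_2))=\beta_{ee}(\lambda(a_1,a_2))$. For a quadratic form $(\lambda,\mu)$, $\lambda$ is hermitian with respect to $*=hp-\mathrm{id}$, so $R$ (forgetting $\mu$ and $\beta_e$) is defined. A commutative quadratic refinement of a hermitian form $\lambda:A\times A\to(M,* )$ is a commutative quadratic form $(\lambda,\mu):A\to\mathfrak M$ with $M_{ee}=M$ and $hp-\mathrm{id}=*$. It is universal if it is initial in the category of commutative quadratic refinements of $\lambda$, whose morphisms are the morphisms of $\mathsf{CQF}$ lying over the identity of $\lambda$ ($\alpha=\mathrm{id}_A$, $\beta_{ee}=\mathrm{id}_M$). *)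

(* Defs.v *)
From HB Require Import structures.
From mathcomp Require Import all_boot all_algebra.
From mathcomp Require Import boolp.

Set Implicit Arguments.
Unset Strict Implicit.
Unset Printing Implicit Defensive.

Import GRing.Theory.
Local Open Scope ring_scope.

Local Obligation Tactic := idtac.

Record category := Category {
  obj :> Type;
  hom : obj -> obj -> Type;
  idm : forall X, hom X X;
  comp : forall X Y Z, hom Y Z -> hom X Y -> hom X Z;
  comp_idl : forall X Y (f : hom X Y), comp (idm Y) f = f;
  comp_idr : forall X Y (f : hom X Y), comp f (idm X) = f;
  compA : forall X Y Z W (f : hom Z W) (g : hom Y Z) (k : hom X Y),
    comp f (comp g k) = comp (comp f g) k }.

Record functor (C D : category) := Functor {
  fobj :> C -> D;
  fmap : forall X Y : C, hom X Y -> hom (fobj X) (fobj Y);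
  fmap_id : forall X : C, fmap (idm X) = idm (fobj X);
  fmap_comp : forall (X Y Z : C) (f : hom Y Z) (g : hom X Y),
    fmap (comp f g) = comp (fmap f) (fmap g) }.

(* L is left adjoint to R: a bijection Hom (L X, Y) ~ Hom (X, R Y), natural in
   X and Y. *)
Definition left_adjoint (C D : category) (L : functor C D) (R : functor D C) :
    Prop :=
  exists phi : forall (X : C) (Y : D), hom (L X) Y -> hom X (R Y),
    [/\ forall X Y, bijective (phi X Y),
        forall X X' Y (u : hom X' X) (f : hom (L X) Y),
          phi X' Y (comp f (fmap L u)) = comp (phi X Y f) u
      & forall X Y Y' (f : hom (L X) Y) (v : hom Y Y'),
          phi X Y' (comp v f) = comp (fmap R v) (phi X Y f)].

Definition initial (C : category) (X : C) : Prop :=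
  forall Y : C, exists f : hom X Y, forall g : hom X Y, g = f.

(* Bilinearity over the integers. *)
Definition biadditive (A M : zmodType) (l : A -> A -> M) : Prop :=
  (forall a b c, l (a + b) c = l a c + l b c) /\
  (forall a b c, l a (b + c) = l a b + l a c).

Lemma additive_ext (U V : zmodType) (f g : {additive U -> V}) : f =1 g -> f = g.
Proof.
move=> efg; have {efg} : (f : U -> V) = g by apply/funext.
case: f g => f [[pf]] [g [[pg]]] /= efg; rewrite efg in pf *.
by rewrite (Prop_irrelevance pf pg).
Qed.

Record quad_group := QuadGroup {
  qg_e : zmodType;
  qg_ee : zmodType;
  qg_h : {additive qg_e -> qg_ee};
  qg_p : {additive qg_ee -> qg_e};
  qg_ph : forall x, qg_p (qg_h x) = x *+ 2 }.

Definition qg_inv (G : quad_group) (m : qg_ee G) : qg_ee G :=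
  qg_h G (qg_p G m) - m.

Lemma qg_inv_nmod (G : quad_group) : nmod_morphism (@qg_inv G).
Proof.
split=> [|x y]; first by rewrite /qg_inv /= !raddf0 addr0.
by rewrite /qg_inv !raddfD /= addrACA.
Qed.

HB.instance Definition _ (G : quad_group) :=
  GRing.isNmodMorphism.Build (qg_ee G) (qg_ee G) (@qg_inv G) (@qg_inv_nmod G).

Lemma qg_invK (G : quad_group) : involutive (@qg_inv G).
Proof.
move=> x; rewrite /qg_inv (raddfB (qg_p G)) /= qg_ph mulr2n addrK.
exact: subKr.
Qed.

Record quad_group_hom (G G' : quad_group) := QuadGroupHom {
  qgh_e : {additive qg_e G -> qg_e G'};
  qgh_ee : {additive qg_ee G -> qg_ee G'};
  qgh_h : forall x, qg_h G' (qgh_e x) = qgh_ee (qg_h G x);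
  qgh_p : forall m, qg_p G' (qgh_ee m) = qgh_e (qg_p G m) }.

Lemma quad_group_hom_ext (G G' : quad_group) (f g : quad_group_hom G G') :
  qgh_e f =1 qgh_e g -> qgh_ee f =1 qgh_ee g -> f = g.
Proof.
case: f g => [fe fee fh fp] [ge gee gh gp] /= /additive_ext e1 /additive_ext e2.
by rewrite -e1 -e2 in gh gp *; congr QuadGroupHom; exact: Prop_irrelevance.
Qed.

Definition quad_group_id (G : quad_group) : quad_group_hom G G :=
  @QuadGroupHom G G idfun idfun (fun=> erefl) (fun=> erefl).

Program Definition quad_group_comp (G1 G2 G3 : quad_group)
    (f : quad_group_hom G2 G3) (g : quad_group_hom G1 G2) :
    quad_group_hom G1 G3 :=
  @QuadGroupHom G1 G3 (qgh_e f \o qgh_e g) (qgh_ee f \o qgh_ee g) _ _.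
Next Obligation. by move=> G1 G2 G3 f g x /=; rewrite !qgh_h. Qed.
Next Obligation. by move=> G1 G2 G3 f g x /=; rewrite !qgh_p. Qed.

Record quad_form := QuadForm {
  qf_src : zmodType;
  qf_grp : quad_group;
  qf_lambda : qf_src -> qf_src -> qg_ee qf_grp;
  qf_mu : qf_src -> qg_e qf_grp;
  qf_lambda_biadd : biadditive qf_lambda;
  qf_muD : forall a b,
    qf_mu (a + b) = qf_mu a + qf_mu b + qg_p qf_grp (qf_lambda a b);
  qf_hmu : forall a, qg_h qf_grp (qf_mu a) = qf_lambda a a }.

Record quad_form_hom (Q Q' : quad_form) := QuadFormHom {
  qfh_alpha : {additive qf_src Q -> qf_src Q'};
  qfh_beta : quad_group_hom (qf_grp Q) (qf_grp Q');
  qfh_lambda : forall a b,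
    qf_lambda (qfh_alpha a) (qfh_alpha b) = qgh_ee qfh_beta (qf_lambda a b);
  qfh_mu : forall a, qf_mu (qfh_alpha a) = qgh_e qfh_beta (qf_mu a) }.

Lemma quad_form_hom_ext (Q Q' : quad_form) (f g : quad_form_hom Q Q') :
  qfh_alpha f =1 qfh_alpha g -> qfh_beta f = qfh_beta g -> f = g.
Proof.
case: f g => [fa fb fl fm] [ga gb gl gm] /= /additive_ext e1 e2.
by rewrite -e1 -e2 in gl gm *; congr QuadFormHom; exact: Prop_irrelevance.
Qed.

Definition quad_form_id (Q : quad_form) : quad_form_hom Q Q :=
  @QuadFormHom Q Q idfun (quad_group_id _) (fun _ _ => erefl) (fun=> erefl).

Program Definition quad_form_comp (Q1 Q2 Q3 : quad_form)
    (f : quad_form_hom Q2 Q3) (g : quad_form_hom Q1 Q2) : quad_form_hom Q1 Q3 :=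
  @QuadFormHom Q1 Q3 (qfh_alpha f \o qfh_alpha g)
    (quad_group_comp (qfh_beta f) (qfh_beta g)) _ _.
Next Obligation. by move=> Q1 Q2 Q3 f g a b /=; rewrite !qfh_lambda. Qed.
Next Obligation. by move=> Q1 Q2 Q3 f g a /=; rewrite !qfh_mu. Qed.

Program Definition CQF : category :=
  @Category quad_form quad_form_hom quad_form_id quad_form_comp _ _ _.
Next Obligation.
by move=> Q Q' f; apply: quad_form_hom_ext => //; apply: quad_group_hom_ext.
Qed.
Next Obligation.
by move=> Q Q' f; apply: quad_form_hom_ext => //; apply: quad_group_hom_ext.
Qed.
Next Obligation.
move=> Q1 Q2 Q3 Q4 f g k; apply: quad_form_hom_ext => //.
exact: quad_group_hom_ext.
Qed.

Record herm_form := HermForm {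
  hf_src : zmodType;
  hf_tgt : zmodType;
  hf_inv : {additive hf_tgt -> hf_tgt};
  hf_invK : involutive hf_inv;
  hf_lambda :> hf_src -> hf_src -> hf_tgt;
  hf_lambda_biadd : biadditive hf_lambda;
  hf_lambdaC : forall a b, hf_lambda b a = hf_inv (hf_lambda a b) }.

Record herm_form_hom (H H' : herm_form) := HermFormHom {
  hfh_alpha : {additive hf_src H -> hf_src H'};
  hfh_beta : {additive hf_tgt H -> hf_tgt H'};
  hfh_inv : forall m, hfh_beta (hf_inv H m) = hf_inv H' (hfh_beta m);
  hfh_lambda : forall a b, H' (hfh_alpha a) (hfh_alpha b) = hfh_beta (H a b) }.

Lemma herm_form_hom_ext (H H' : herm_form) (f g : herm_form_hom H H') :
  hfh_alpha f =1 hfh_alpha g -> hfh_beta f =1 hfh_beta g -> f = g.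
Proof.
case: f g => [fa fb fi fl] [ga gb gi gl] /= /additive_ext e1 /additive_ext e2.
by rewrite -e1 -e2 in gi gl *; congr HermFormHom; exact: Prop_irrelevance.
Qed.

Definition herm_form_id (H : herm_form) : herm_form_hom H H :=
  @HermFormHom H H idfun idfun (fun=> erefl) (fun _ _ => erefl).

Program Definition herm_form_comp (H1 H2 H3 : herm_form)
    (f : herm_form_hom H2 H3) (g : herm_form_hom H1 H2) : herm_form_hom H1 H3 :=
  @HermFormHom H1 H3 (hfh_alpha f \o hfh_alpha g) (hfh_beta f \o hfh_beta g)
    _ _.
Next Obligation. by move=> H1 H2 H3 f g a /=; rewrite !hfh_inv. Qed.
Next Obligation. by move=> H1 H2 H3 f g a b /=; rewrite !hfh_lambda. Qed.

Program Definition HF : category :=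
  @Category herm_form herm_form_hom herm_form_id herm_form_comp _ _ _.
Next Obligation. by move=> H H' f; apply: herm_form_hom_ext. Qed.
Next Obligation. by move=> H H' f; apply: herm_form_hom_ext. Qed.
Next Obligation. by move=> H1 H2 H3 H4 f g k; apply: herm_form_hom_ext. Qed.

Lemma qf_lambda_herm (Q : quad_form) (a b : qf_src Q) :
  qf_lambda b a = qg_inv (qf_lambda a b).
Proof.
have := qf_hmu (a + b); rewrite qf_muD !raddfD /= !qf_hmu.
have [lD rD] := qf_lambda_biadd Q; rewrite lD !rD /qg_inv.
rewrite [qf_lambda b a + _]addrC [RHS]addrACA => /addrI ->.
by rewrite addrC addrK.
Qed.

Definition forget_obj (Q : quad_form) : herm_form :=
  @HermForm (qf_src Q) (qg_ee (qf_grp Q)) (@qg_inv (qf_grp Q)) (@qg_invK _)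
    (@qf_lambda Q) (qf_lambda_biadd Q) (@qf_lambda_herm Q).

Program Definition forget_hom (Q Q' : quad_form) (f : quad_form_hom Q Q') :
    herm_form_hom (forget_obj Q) (forget_obj Q') :=
  @HermFormHom (forget_obj Q) (forget_obj Q') (qfh_alpha f)
    (qgh_ee (qfh_beta f)) _ (qfh_lambda f).
Next Obligation.
by move=> Q Q' f m /=; rewrite /qg_inv raddfB /= qgh_p qgh_h.
Qed.

Program Definition forget : functor CQF HF :=
  @Functor CQF HF forget_obj forget_hom _ _.
Next Obligation. by move=> Q; apply: herm_form_hom_ext. Qed.
Next Obligation. by move=> Q1 Q2 Q3 f g; apply: herm_form_hom_ext. Qed.

(* A commutative quadratic form on the source of H whose bilinear part is H:
   M_ee is literally hf_tgt H, so that only the remaining data are recorded. *)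
Record refinement (H : herm_form) := Refinement {
  ref_e : zmodType;
  ref_h : {additive ref_e -> hf_tgt H};
  ref_p : {additive hf_tgt H -> ref_e};
  ref_mu : hf_src H -> ref_e;
  ref_ph : forall x, ref_p (ref_h x) = x *+ 2;
  ref_inv : forall m, ref_h (ref_p m) - m = hf_inv H m;
  ref_muD : forall a b, ref_mu (a + b) = ref_mu a + ref_mu b + ref_p (H a b);
  ref_hmu : forall a, ref_h (ref_mu a) = H a a }.

Definition ref_form (H : herm_form) (r : refinement H) : quad_form :=
  @QuadForm (hf_src H) (QuadGroup (@ref_ph H r)) H (@ref_mu H r)
    (hf_lambda_biadd H) (@ref_muD H r) (@ref_hmu H r).

Record refinement_hom (H : herm_form) (r s : refinement H) := RefinementHom {
  rh_hom : quad_form_hom (ref_form r) (ref_form s);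
  rh_alpha : forall a, qfh_alpha rh_hom a = a;
  rh_beta_ee : forall m, qgh_ee (qfh_beta rh_hom) m = m }.

Lemma refinement_hom_ext (H : herm_form) (r s : refinement H)
  (f g : refinement_hom r s) : rh_hom f = rh_hom g -> f = g.
Proof.
case: f g => [f fa fb] [g ga gb] /= e; rewrite -e in ga gb *.
by congr RefinementHom; exact: Prop_irrelevance.
Qed.

Definition refinement_id (H : herm_form) (r : refinement H) :
    refinement_hom r r :=
  @RefinementHom H r r (quad_form_id (ref_form r)) (fun=> erefl) (fun=> erefl).

Program Definition refinement_comp (H : herm_form) (r s t : refinement H)
    (f : refinement_hom s t) (g : refinement_hom r s) : refinement_hom r t :=
  @RefinementHom H r t (quad_form_comp (rh_hom f) (rh_hom g)) _ _.
Next Obligation. by move=> H r s t f g a; rewrite /= rh_alpha; exact: rh_alpha. Qed.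
Next Obligation. by move=> H r s t f g a; rewrite /= rh_beta_ee; exact: rh_beta_ee. Qed.

Program Definition refinements (H : herm_form) : category :=
  @Category (refinement H) (@refinement_hom H) (@refinement_id H)
    (@refinement_comp H) _ _ _.
Next Obligation.
by move=> H r s f; apply: refinement_hom_ext; exact: (@comp_idl CQF).
Qed.
Next Obligation.
by move=> H r s f; apply: refinement_hom_ext; exact: (@comp_idr CQF).
Qed.
Next Obligation.
by move=> H r s t u f g k; apply: refinement_hom_ext; exact: (@compA CQF).
Qed.

Definition universal (H : herm_form) (r : refinement H) : Prop :=
  initial (r : refinements H).

(* Main.v *)
From HB Require Import structures.
From mathcomp Require Import all_boot ssralg ring_quotient boolp.
Require Import Defs.

Set Implicit Arguments.
Unset Strict Implicit.
Unset Printing Implicit Defensive.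

Import GRing.Theory.
Local Open Scope ring_scope.

(** Let [H : A * A -> (M, inv)] be a hermitian form, with [inv] its
    involution.  In any quadratic refinement the group [M_e] receives an
    additive map [p] from [M] and a map [mu] from [A] subject to

      (1) [p (inv m) = p m],
      (2) [mu (a + b) = mu a + mu b + p (H a b)],
      (3) [2 mu a = p (H a a)],

    where (1) and (3) are [p h p = 2 p] and [p h mu = 2 mu].  The universal
    refinement is the abelian group presented by generators [p m] and [mu a]
    and these relations.  The map [h] exists by the universal property: the
    pair [m |-> m + inv m], [a |-> H a a] with values in [M] satisfies the
    three relations.  For any other form [Q] and any morphism [u] from [H] to
    the hermitian form of [Q], the pair [m |-> p (u m)], [a |-> mu (u a)]
    satisfies them too, and so induces the only possible [beta_e].  Hence [H]
    has a universal arrow to the forgetful functor, and universal arrows at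
    every object assemble to a left adjoint ([universal_arrows_left_adjoint]).
    Initiality among the refinements of [H] is the case of that universal
    property where [u] is the identity on [A] and [M].

    The presented group is built without a free group.  Relation (1) is imposed
    by passing to the coinvariants of [M].  Relation (2) then says that [mu] is
    a section of an extension of [A] by the coinvariants with cocycle [H]; this
    cocycle is symmetric there because of (1), so the extension is an abelian
    group on the set of pairs ([twisted_of]).  Finally, in the presence of (1) and
    (2), [2 mu a - p (H a a)] is additive in [a], so that (3) is imposed by
    taking a cokernel. *)

(** * Left adjoints from universal arrows *)

(** The arrows [eta X] are only assumed to be universal one object at a time:
    the action of the left adjoint on a morphism [u] is forced, being the
    extension of [eta Y] after [u], and functoriality and naturality follow from
    uniqueness of extensions.  The adjunction sends [f] to its restriction along
    [eta X], with inverse [ext]. *)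
Theorem universal_arrows_left_adjoint (C D : category) (R : functor D C)
    (F : C -> D) (eta : forall X : C, hom X (R (F X)))
    (ext : forall (X : C) (Y : D), hom X (R Y) -> hom (F X) Y)
    (extK : forall X Y (u : hom X (R Y)), comp (fmap R (ext X Y u)) (eta X) = u)
    (ext_uniq : forall X Y (g g' : hom (F X) Y),
      comp (fmap R g) (eta X) = comp (fmap R g') (eta X) -> g = g') :
  exists L : functor C D,
    (forall X : C, fobj L X = F X) /\ left_adjoint L R.
Proof.
pose Lmap X Y (u : hom X Y) := ext X (F Y) (comp (eta Y) u).
have Lmap_id X : Lmap X X (idm X) = idm (F X).
  by apply: ext_uniq; rewrite /Lmap extK fmap_id comp_idl comp_idr.
have Lmap_comp X Y Z (f : hom Y Z) (g : hom X Y) :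
    Lmap X Z (comp f g) = comp (Lmap Y Z f) (Lmap X Y g).
  by apply: ext_uniq; rewrite /Lmap fmap_comp -[RHS]compA !extK !compA extK.
exists (Functor Lmap_id Lmap_comp); split=> //.
exists (fun X Y (f : hom (F X) Y) => comp (fmap R f) (eta X)); split.
- move=> X Y; exists (ext X Y) => [f | u]; last exact: extK.
  by apply: ext_uniq; rewrite extK.
- by move=> X X' Y u f /=; rewrite fmap_comp -!compA extK.
- by move=> X Y Y' f v; rewrite fmap_comp compA.
Qed.

(** * Cokernels of abelian groups *)

Section Cokernel.
Variables (U V : zmodType) (f : {additive U -> V}).

(** The quotients of abelian groups are taken by boolean predicates, whence the
    classical truth value. *)
Definition in_image : {pred V} := fun v => `[< exists u, v = f u >].

Lemma in_image_zmod_closed : zmod_closed in_image.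
Proof.
split=> [|x y /asboolP[u ->] /asboolP[v ->]]; apply/asboolP.
  by exists 0; rewrite raddf0.
by exists (u - v); rewrite raddfB.
Qed.

HB.instance Definition _ :=
  GRing.isZmodClosed.Build V in_image in_image_zmod_closed.

Definition coker : zmodType := Quotient.quot in_image.

Definition coker_proj : {additive V -> coker} :=
  (\pi_(Quotient.quot in_image))%qT.

Lemma coker_proj_surj (z : coker) : exists v, z = coker_proj v.
Proof. by exists (repr z); rewrite /coker_proj /= reprK. Qed.

Lemma coker_projE (x y : V) :
  coker_proj x = coker_proj y <-> exists u, x - y = f u.
Proof.
split=> [/eqP | xy]; first by rewrite -Quotient.idealrBE => /asboolP.
by apply/eqP; rewrite -Quotient.idealrBE; apply/asboolP.
Qed.

Lemma coker_proj_image (u : U) : coker_proj (f u) = 0.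
Proof.
by rewrite -(raddf0 coker_proj); apply/coker_projE; exists u; rewrite subr0.
Qed.

Variables (W : zmodType) (g : {additive V -> W}) (gf0 : forall u, g (f u) = 0).

Definition coker_lift_fun (z : coker) : W := g (repr z).

Lemma coker_lift_funE (v : V) : coker_lift_fun (coker_proj v) = g v.
Proof.
have /coker_projE[u e] : coker_proj (repr (coker_proj v)) = coker_proj v.
  by rewrite /coker_proj /= reprK.
by apply/eqP; rewrite -subr_eq0 /coker_lift_fun -raddfB e gf0.
Qed.

Lemma coker_lift_zmod_morphism : zmod_morphism coker_lift_fun.
Proof.
move=> x y; have [v ->] := coker_proj_surj x; have [w ->] := coker_proj_surj y.
by rewrite -raddfB !coker_lift_funE raddfB.
Qed.

HB.instance Definition _ :=
  GRing.isZmodMorphism.Build coker W coker_lift_fun coker_lift_zmod_morphism.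

Definition coker_lift : {additive coker -> W} := coker_lift_fun.

Lemma coker_liftE (v : V) : coker_lift (coker_proj v) = g v.
Proof. exact: coker_lift_funE. Qed.

End Cokernel.

(** * Abelian extensions with a biadditive cocycle *)

Section Twisted.
Variables (A P : zmodType) (c : A -> A -> P).
Hypotheses (c_biadd : biadditive c) (c_sym : forall a b, c b a = c a b).

Let cDl a b d : c (a + b) d = c a d + c b d. Proof. exact: c_biadd.1. Qed.
Let cDr a b d : c a (b + d) = c a b + c a d. Proof. exact: c_biadd.2. Qed.

Let c0l a : c 0 a = 0.
Proof. by apply: (addrI (c 0 a)); rewrite -cDl !addr0. Qed.

Let cNl a b : c (- a) b = - c a b.
Proof. by apply: (addrI (c a b)); rewrite -cDl !subrr c0l. Qed.

(** The proofs are parameters of the type so that the group structure below can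
    be attached to it. *)
Definition twisted_of of biadditive c & (forall a b, c b a = c a b) : Type :=
  (P * A)%type.
Local Notation twisted := (twisted_of c_biadd c_sym).

HB.instance Definition _ := Choice.on twisted.

(** The cocycle is subtracted so that [a |-> (0, a)] satisfies
    [s (a + b) = s a + s b + c a b]. *)
Definition twisted_add (x y : twisted) : twisted :=
  (x.1 + y.1 - c x.2 y.2, x.2 + y.2).
Definition twisted_opp (x : twisted) : twisted := (- x.1 - c x.2 x.2, - x.2).

Lemma twisted_addA : associative twisted_add.
Proof.
move=> [x a] [y b] [z d]; congr pair; last exact: addrA.
by rewrite /= cDl cDr !opprD !addrA [LHS](ACl (1*2*5*3*6*4)).
Qed.

Lemma twisted_addC : commutative twisted_add.
Proof.
by move=> [x a] [y b]; rewrite /twisted_add /= c_sym (addrC x) (addrC a).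
Qed.

Lemma twisted_add0 : left_id (0, 0) twisted_add.
Proof. by move=> [x a]; rewrite /twisted_add /= c0l subr0 !add0r. Qed.

Lemma twisted_addN : left_inverse (0, 0) twisted_opp twisted_add.
Proof.
move=> [x a]; rewrite /twisted_add /= cNl addNr opprK; congr pair.
by rewrite addrAC subrK addNr.
Qed.

HB.instance Definition _ := GRing.isZmodule.Build twisted
  twisted_addA twisted_addC twisted_add0 twisted_addN.

Definition twisted_inj_fun (x : P) : twisted := (x, 0).
Definition twisted_sec (a : A) : twisted := (0, a).

Lemma twisted_inj_nmod_morphism : nmod_morphism twisted_inj_fun.
Proof.
by split=> // x y; congr pair; rewrite /= ?addr0 // c0l subr0.
Qed.

HB.instance Definition _ := GRing.isNmodMorphism.Build P twisted
  twisted_inj_fun twisted_inj_nmod_morphism.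

Definition twisted_inj : {additive P -> twisted} := twisted_inj_fun.

Lemma twistedE (z : twisted) : z = twisted_inj z.1 + twisted_sec z.2.
Proof.
by case: z => x a; congr pair; rewrite /= ?add0r // c0l subr0 addr0.
Qed.

Lemma twisted_secD (a b : A) :
  twisted_sec (a + b) = twisted_sec a + twisted_sec b + twisted_inj (c a b).
Proof.
congr pair; rewrite /= ?addr0 //.
by rewrite [c (a + b) 0]c_sym c0l subr0 add0r addNr.
Qed.

Variables (W : zmodType) (f : {additive P -> W}) (q : A -> W).
Hypothesis qD : forall a b, q (a + b) = q a + q b + f (c a b).

Definition twisted_lift_fun (z : twisted) : W := f z.1 + q z.2.

Lemma twisted_lift_nmod_morphism : nmod_morphism twisted_lift_fun.
Proof.
split=> [|x y].
  apply: (addrI (q 0)); rewrite /twisted_lift_fun /= raddf0 add0r addr0.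
  by rewrite -[in RHS](addr0 (0 : A)) qD c0l raddf0 addr0.
rewrite /twisted_lift_fun /= qD raddfB raddfD /= !addrA.
by rewrite [LHS](ACl (1*4*2*5*(3*6))) /= addNr addr0.
Qed.

HB.instance Definition _ := GRing.isNmodMorphism.Build twisted W
  twisted_lift_fun twisted_lift_nmod_morphism.

Definition twisted_lift : {additive twisted -> W} := twisted_lift_fun.

Lemma twisted_lift_inj (x : P) : twisted_lift (twisted_inj x) = f x.
Proof.
have q0 : q 0 = 0.
  by have := raddf0 twisted_lift; rewrite /= /twisted_lift_fun /= raddf0 add0r.
by rewrite /= /twisted_lift_fun /= q0 addr0.
Qed.

Lemma twisted_lift_sec (a : A) : twisted_lift (twisted_sec a) = q a.
Proof. by rewrite /= /twisted_lift_fun /= raddf0 add0r. Qed.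

End Twisted.

(** * The presented value group *)

Section ValueGroup.
Variable H : herm_form.
Local Notation A := (hf_src H).
Local Notation M := (hf_tgt H).

Lemma hf_addl (a b d : A) : H (a + b) d = H a d + H b d.
Proof. exact: (hf_lambda_biadd H).1. Qed.

Lemma hf_addr (a b d : A) : H a (b + d) = H a b + H a d.
Proof. exact: (hf_lambda_biadd H).2. Qed.

(** The relations (1), (2) and (3) of the introduction, for a pair of maps into
    an arbitrary abelian group. *)
Record refining (W : zmodType) (p : M -> W) (mu : A -> W) : Prop := Refining {
  refining_inv : forall m, p (hf_inv H m) = p m;
  refining_muD : forall a b, mu (a + b) = mu a + mu b + p (H a b);
  refining_mu2 : forall a, mu a *+ 2 = p (H a a) }.

(** Both [2 mu a] and [p (H a a)] are quadratic in [a] with the same deviation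
    from additivity: it is [2 p (H a b)] for the first and
    [p (H a b) + p (H b a)] for the second, and [p (H b a) = p (H a b)]. *)
Lemma mu2_nmod_morphism (W : zmodType) (p : {additive M -> W}) (mu : A -> W) :
    (forall m, p (hf_inv H m) = p m) ->
    (forall a b, mu (a + b) = mu a + mu b + p (H a b)) ->
  nmod_morphism (fun a => mu a *+ 2 - p (H a a)).
Proof.
move=> pinv muD; pose d a := mu a *+ 2 - p (H a a).
have dD : {morph d : a b / a + b}.
  move=> a b; rewrite /d muD hf_addl !hf_addr !(raddfD p).
  rewrite [H b a]hf_lambdaC pinv !mulrnDl [p (H a b) *+ 2]mulr2n.
  rewrite !opprD !addrA [LHS](ACl (1*6*2*3*9*(4*7)*(5*8))) /=.
  by rewrite !subrr !addr0.
by split=> //; apply: (addrI (d 0)); rewrite -[RHS]/(d 0 + 0) -dD !addr0.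
Qed.

Definition anti (m : M) : M := hf_inv H m - m.

Lemma anti_zmod_morphism : zmod_morphism anti.
Proof. by move=> x y; rewrite /anti raddfB /= !opprD addrACA. Qed.

HB.instance Definition _ :=
  GRing.isZmodMorphism.Build M M anti anti_zmod_morphism.

Definition coinvariants : zmodType := coker anti.

Definition coinv_proj : {additive M -> coinvariants} := coker_proj anti.

Lemma coinv_proj_inv (m : M) : coinv_proj (hf_inv H m) = coinv_proj m.
Proof. by apply/coker_projE; exists m. Qed.

Definition cocycle (a b : A) : coinvariants := coinv_proj (H a b).

Lemma cocycle_biadd : biadditive cocycle.
Proof. by split=> a b d; rewrite /cocycle ?hf_addl ?hf_addr raddfD. Qed.

Lemma cocycle_sym (a b : A) : cocycle b a = cocycle a b.
Proof. by rewrite /cocycle hf_lambdaC coinv_proj_inv. Qed.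

Definition extension : zmodType := twisted_of cocycle_biadd cocycle_sym.

Definition ext_p : {additive M -> extension} :=
  twisted_inj cocycle_biadd cocycle_sym \o coinv_proj.

Definition ext_mu : A -> extension := twisted_sec cocycle_biadd cocycle_sym.

Lemma ext_muD (a b : A) : ext_mu (a + b) = ext_mu a + ext_mu b + ext_p (H a b).
Proof. exact: twisted_secD. Qed.

Lemma ext_p_inv (m : M) : ext_p (hf_inv H m) = ext_p m.
Proof. by rewrite /ext_p /= coinv_proj_inv. Qed.

Definition defect (a : A) : extension := ext_mu a *+ 2 - ext_p (H a a).

Lemma defect_nmod_morphism : nmod_morphism defect.
Proof. exact: (mu2_nmod_morphism ext_p_inv ext_muD). Qed.

HB.instance Definition _ :=
  GRing.isNmodMorphism.Build A extension defect defect_nmod_morphism.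

Definition value_group : zmodType := coker defect.

Definition univ_p : {additive M -> value_group} := coker_proj defect \o ext_p.

Definition univ_mu (a : A) : value_group := coker_proj defect (ext_mu a).

(** Each relation was imposed, or made to hold, by one stage of the
    construction: (1) by the coinvariants, (2) by the extension, (3) by the
    cokernel. *)
Lemma univ_refining : refining univ_p univ_mu.
Proof.
split=> [m | a b | a].
- exact: (congr1 (coker_proj defect) (ext_p_inv m)).
- by rewrite /univ_mu ext_muD !raddfD.
- have : coker_proj defect (ext_mu a *+ 2 - ext_p (H a a)) = 0.
    exact: (coker_proj_image defect a).
  by rewrite raddfB raddfMn => /subr0_eq.
Qed.

(** Sums of two generators suffice: the [p m] form a subgroup, and by (2)
    [mu] is additive modulo it. *)
Lemma value_group_gen (z : value_group) : exists m a, z = univ_p m + univ_mu a.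
Proof.
have [y ->] := coker_proj_surj z; have [m em] := coker_proj_surj y.1.
have ey : y = ext_p m + ext_mu y.2 by rewrite [LHS]twistedE em.
by exists m, y.2; rewrite [in LHS]ey raddfD.
Qed.

Lemma value_group_ext (W : zmodType) (g g' : {additive value_group -> W}) :
    (forall m, g (univ_p m) = g' (univ_p m)) ->
    (forall a, g (univ_mu a) = g' (univ_mu a)) ->
  g =1 g'.
Proof.
move=> ep emu z; have [m [a ->]] := value_group_gen z.
by rewrite !raddfD /= ep emu.
Qed.

Section Lift.
Variables (W : zmodType) (p : {additive M -> W}) (mu : A -> W).
Hypothesis pmu : refining p mu.

Lemma lift_anti (m : M) : p (anti m) = 0.
Proof. by rewrite /anti raddfB /= (refining_inv pmu) subrr. Qed.

Definition coinv_lift : {additive coinvariants -> W} := coker_lift lift_anti.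

Lemma coinv_lift_muD (a b : A) :
  mu (a + b) = mu a + mu b + coinv_lift (cocycle a b).
Proof. by rewrite coker_liftE (refining_muD pmu). Qed.

Definition extension_lift : {additive extension -> W} :=
  twisted_lift cocycle_biadd cocycle_sym coinv_lift_muD.

Lemma extension_lift_p (m : M) : extension_lift (ext_p m) = p m.
Proof. by rewrite [LHS]twisted_lift_inj coker_liftE. Qed.

Lemma extension_lift_mu (a : A) : extension_lift (ext_mu a) = mu a.
Proof. exact: twisted_lift_sec. Qed.

Lemma lift_defect (a : A) : extension_lift (defect a) = 0.
Proof.
rewrite /defect raddfB raddfMn extension_lift_p extension_lift_mu.
by rewrite (refining_mu2 pmu) subrr.
Qed.

(** The universal property of the presented group: a pair of maps satisfying
    the relations descends through the three stages in turn. *)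
Definition value_lift : {additive value_group -> W} := coker_lift lift_defect.

Lemma value_lift_p (m : M) : value_lift (univ_p m) = p m.
Proof. by rewrite [LHS]coker_liftE extension_lift_p. Qed.

Lemma value_lift_mu (a : A) : value_lift (univ_mu a) = mu a.
Proof. by rewrite [LHS]coker_liftE extension_lift_mu. Qed.

End Lift.

(** * The universal refinement *)

Definition symm (m : M) : M := hf_inv H m + m.

Lemma symm_nmod_morphism : nmod_morphism symm.
Proof.
split=> [|x y]; first by rewrite /symm raddf0 addr0.
by rewrite /symm raddfD addrACA.
Qed.

HB.instance Definition _ :=
  GRing.isNmodMorphism.Build M M symm symm_nmod_morphism.

(** The values that [h] must take on the generators: [h p m = inv m + m] because
    [h p - 1] is to be the involution, and [h mu a = H a a].  The relations hold
    since [H b a = inv (H a b)]. *)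
Lemma symm_refining : refining symm (fun a => H a a).
Proof.
split=> [m | a b | a].
- by rewrite /symm hf_invK addrC.
- by rewrite hf_addl !hf_addr /symm -hf_lambdaC addrCA -!addrA addrCA
             [H b b + _]addrC -addrA.
- by rewrite /symm -hf_lambdaC.
Qed.

Definition univ_h : {additive value_group -> M} := value_lift symm_refining.

Lemma univ_hp (m : M) : univ_h (univ_p m) = symm m.
Proof. exact: value_lift_p. Qed.

Lemma univ_hmu (a : A) : univ_h (univ_mu a) = H a a.
Proof. exact: (value_lift_mu symm_refining). Qed.

(** On [p m] this is (1), and on [mu a] it is (3). *)
Lemma univ_ph (x : value_group) : univ_p (univ_h x) = x *+ 2.
Proof.
have [pinv _ mu2] := univ_refining; have [m [a ->]] := value_group_gen x.
rewrite (raddfD univ_h) univ_hp univ_hmu mulrnDl mu2 (raddfD univ_p) /symm.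
by rewrite (raddfD univ_p) pinv.
Qed.

Lemma univ_inv (m : M) : univ_h (univ_p m) - m = hf_inv H m.
Proof. by rewrite univ_hp addrK. Qed.

Definition univ_refinement : refinement H :=
  @Refinement H value_group univ_h univ_p univ_mu univ_ph univ_inv
    (refining_muD univ_refining) univ_hmu.

End ValueGroup.

(** * The universal property *)

(** A morphism and not an equality: the involution of [forget_obj (ref_form r)]
    is [h p - 1], which agrees with that of [H] only up to a proof. *)
Definition refinement_unit (H : herm_form) (r : refinement H) :
    herm_form_hom H (forget_obj (ref_form r)) :=
  @HermFormHom H (forget_obj (ref_form r)) idfun idfun
    (fun m => esym (ref_inv r m)) (fun _ _ => erefl).

Section Extend.
Variables (H : herm_form) (Q : quad_form) (u : herm_form_hom H (forget_obj Q)).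

Definition pull_p : {additive hf_tgt H -> qg_e (qf_grp Q)} :=
  qg_p (qf_grp Q) \o hfh_beta u.

Definition pull_mu (a : hf_src H) : qg_e (qf_grp Q) := qf_mu (hfh_alpha u a).

(** In any quadratic form, [p (h p x - x) = 2 p x - p x = p x], which is (1),
    and [2 mu a = p h mu a = p (lambda a a)], which is (3). *)
Lemma pull_refining : refining pull_p pull_mu.
Proof.
split=> [m | a b | a]; rewrite /pull_p /pull_mu /=.
- by rewrite hfh_inv /= /qg_inv raddfB /= qg_ph mulr2n addrK.
- by rewrite raddfD qf_muD -hfh_lambda.
- by rewrite -hfh_lambda -qg_ph qf_hmu.
Qed.

Definition extend_e : {additive value_group H -> qg_e (qf_grp Q)} :=
  value_lift pull_refining.

Lemma extend_p (m : hf_tgt H) :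
  qg_p (qf_grp Q) (hfh_beta u m) = extend_e (univ_p H m).
Proof. exact/esym/(value_lift_p pull_refining). Qed.

Lemma extend_mu (a : hf_src H) : qf_mu (hfh_alpha u a) = extend_e (univ_mu a).
Proof. exact/esym/(value_lift_mu pull_refining). Qed.

Lemma extend_h (x : value_group H) :
  qg_h (qf_grp Q) (extend_e x) = hfh_beta u (univ_h H x).
Proof.
have [m [a ->]] := value_group_gen x.
rewrite (raddfD extend_e) (raddfD (univ_h H)) univ_hp univ_hmu -extend_p.
rewrite -extend_mu !raddfD qf_hmu -hfh_lambda hfh_inv; congr (_ + _).
by rewrite /= /qg_inv subrK.
Qed.

Definition extend_grp :
    quad_group_hom (qf_grp (ref_form (univ_refinement H))) (qf_grp Q) :=
  @QuadGroupHom (qf_grp (ref_form (univ_refinement H))) (qf_grp Q)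
    extend_e (hfh_beta u) extend_h extend_p.

(** Its existence for every [u] is the first half of the universal property of
    [univ_refinement H]; [univ_refinement_hom_ext] below is the second. *)
Definition extend : quad_form_hom (ref_form (univ_refinement H)) Q :=
  @QuadFormHom (ref_form (univ_refinement H)) Q (hfh_alpha u) extend_grp
    (hfh_lambda u) extend_mu.

End Extend.

(** A morphism out of the universal refinement is determined by what it does on
    [A] and on [M], because these determine it on the generators of [M_e]. *)
Lemma univ_refinement_hom_ext (H : herm_form) (Q : quad_form)
    (f g : quad_form_hom (ref_form (univ_refinement H)) Q) :
  qfh_alpha f =1 qfh_alpha g ->
  qgh_ee (qfh_beta f) =1 qgh_ee (qfh_beta g) -> f = g.
Proof.
move=> ea eb; apply: quad_form_hom_ext => //; apply: quad_group_hom_ext => //.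
apply: value_group_ext => [m | a].
  by have := qgh_p (qfh_beta f) m; rewrite eb (qgh_p (qfh_beta g)).
by have := qfh_mu f a; rewrite ea (qfh_mu g).
Qed.

Lemma univ_refinement_universal (H : herm_form) :
  universal (univ_refinement H).
Proof.
move=> s; exists (@RefinementHom H (univ_refinement H) s
  (extend (refinement_unit s)) (fun=> erefl) (fun=> erefl)) => g.
apply: refinement_hom_ext; apply: univ_refinement_hom_ext => x /=.
  exact: rh_alpha.
exact: rh_beta_ee.
Qed.

Theorem theorem25 :
  exists muc : forall lam : herm_form, refinement lam,
    (forall lam : herm_form, universal (muc lam)) /\
    exists L : functor HF CQF,
      (forall lam : herm_form, fobj L lam = ref_form (muc lam)) /\
      left_adjoint L forget.
Proof.
exists univ_refinement; split; first exact: univ_refinement_universal.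
apply: (@universal_arrows_left_adjoint HF CQF forget
          (fun H => ref_form (univ_refinement H))
          (fun H => refinement_unit (univ_refinement H))
          (fun H Q => @extend H Q)) => [H Q u | H Q g g' e].
  exact: herm_form_hom_ext.
apply: univ_refinement_hom_ext => x.
  exact: (congr1 (fun v : herm_form_hom H (forget_obj Q) => hfh_alpha v x) e).
exact: (congr1 (fun v : herm_form_hom H (forget_obj Q) => hfh_beta v x) e).
Qed.
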